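(* Let $S$ be a positive definite complex matrix and $T$ a positive semi-definite complex matrix of the same size. (1) For all real $t,s$ with $\frac23\le t\le 1$ and $0\le s\le\frac23$, $$S\sharp T\le\left(S\sharp_{t/2}T\right)S^{-1}\left(S\sharp_{1-t}(S\nabla T)\right)\le S\ell T\le s\,(S\sharp T)+(1-s)\,(S\nabla T)\le S\nabla T.$$ (2) For every real $p\ge\frac13$, $$S\ell T\le S^{1/2}\left(\frac{\left(S^{-1/2}TS^{-1/2}\right)^p+I}{2}\right)^{1/p}S^{1/2}.$$
   Context: For Hermitian matrices, $X\le Y$ means that $Y-X$ is positive semi-definite (Loewner order). For $S$ positive definite, $T$ positive semi-definite and $0\le v\le1$: $S\nabla_vT:=(1-v)S+vT$, $S\sharp_vT:=S^{1/2}\left(S^{-1/2}TS^{-1/2}\right)^vS^{1/2}$, with $\nabla:=\nabla_{1/2}$ and $\sharp:=\sharp_{1/2}$. The logarithmic mean is $S\ell T:=\int_0^1S\sharp_vT\,dv$. $I$ is the identity matrix; real powers of positive semi-definite matrices are taken by functional calculus. *)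

(* Defs.v *)
From mathcomp Require Import all_boot all_order all_algebra.
From mathcomp Require Import complex.
From mathcomp Require Import all_classical all_reals all_analysis.

Set Implicit Arguments.
Unset Strict Implicit.
Unset Printing Implicit Defensive.

Import Order.TTheory GRing.Theory Num.Theory.

Local Open Scope ring_scope.
Local Open Scope complex_scope.
Local Open Scope sesquilinear_scope.

(* The order of [R[i]] is partial: [0 <= z] (resp. [0 < z]) says that [z] is
   real and nonnegative (resp. positive). *)
Definition posdefmx (R : realType) (n : nat) (A : 'M[R[i]]_n) : Prop :=
  A \is hermsymmx /\
  (forall x : 'cV[R[i]]_n, x != 0 -> 0 < (x^t* *m A *m x) 0 0).

Definition possemidefmx (R : realType) (n : nat) (A : 'M[R[i]]_n) : Prop :=
  A \is hermsymmx /\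
  (forall x : 'cV[R[i]]_n, 0 <= (x^t* *m A *m x) 0 0).

Definition loewner (R : realType) (n : nat) (X Y : 'M[R[i]]_n) : Prop :=
  [/\ X \is hermsymmx, Y \is hermsymmx & possemidefmx (Y - X)].

(* Functional calculus, meant for Hermitian [A]: its eigenvalues, listed by
   [spectral_diag A], are then real, so that [complex.Re] loses nothing, and
   [A] itself is recovered for [f := id] (see [orthomx_spectralP]). *)
Definition hermfun (R : realType) (n : nat) (f : R -> R) (A : 'M[R[i]]_n) :
    'M[R[i]]_n :=
  invmx (spectralmx A)
  *m diag_mx (map_mx (fun z => (f (complex.Re z))%:C) (spectral_diag A))
  *m spectralmx A.

(* [powR] has [0 `^ 0 = 1], so [mxpowR A 0 = 1%:M] even for singular [A]. *)
Definition mxpowR (R : realType) (n : nat) (A : 'M[R[i]]_n) (p : R) :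
    'M[R[i]]_n :=
  hermfun (fun a => a `^ p) A.

Definition wamean (R : realType) (n : nat) (v : R) (S T : 'M[R[i]]_n) :
    'M[R[i]]_n :=
  (1 - v)%:C *: S + v%:C *: T.

Definition relmx (R : realType) (n : nat) (S T : 'M[R[i]]_n) : 'M[R[i]]_n :=
  mxpowR S (- 2^-1) *m T *m mxpowR S (- 2^-1).

Definition wgmean (R : realType) (n : nat) (v : R) (S T : 'M[R[i]]_n) :
    'M[R[i]]_n :=
  mxpowR S 2^-1 *m mxpowR (relmx S T) v *m mxpowR S 2^-1.

Definition mxint01 (R : realType) (n : nat) (F : R -> 'M[R[i]]_n) :
    'M[R[i]]_n :=
  \matrix_(i, j)
    ((\int[lebesgue_measure]_(v in `[0%R, 1%R]) complex.Re (F v i j))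
     +i* (\int[lebesgue_measure]_(v in `[0%R, 1%R]) complex.Im (F v i j))).

Definition logmean (R : realType) (n : nat) (S T : 'M[R[i]]_n) : 'M[R[i]]_n :=
  mxint01 (fun v => wgmean v S T).

Declare Scope opmean_scope.
Delimit Scope opmean_scope with OM.
Notation "X <=L Y" := (loewner X Y) (at level 70) : opmean_scope.
Notation amean S T := (wamean 2^-1 S T).
Notation gmean S T := (wgmean 2^-1 S T).

(* Main.v *)
Require Import Defs.
From mathcomp Require Import all_boot all_order all_algebra.
From mathcomp Require Import complex.
From mathcomp Require Import all_classical all_reals all_analysis.
From mathcomp Require Import ring lra.

Set Implicit Arguments.
Unset Strict Implicit.
Unset Printing Implicit Defensive.

Import Order.TTheory GRing.Theory Num.Theory.
Import numFieldNormedType.Exports.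

Local Open Scope ring_scope.
Local Open Scope complex_scope.
Local Open Scope opmean_scope.

(** Put X = S^(-1/2) T S^(-1/2), a positive semi-definite matrix, and write
    X = U^* diag(a) U with U unitary and a >= 0.  With M = U S^(1/2), each of
    the matrices being compared has the form M^* diag(f(a)) M for some real
    function f: S corresponds to f = 1, T to f(a) = a, the weighted geometric
    mean to a^v, the logarithmic mean to L(a) = int_0^1 a^v dv, and a factor
    S^(-1) between two such matrices multiplies the functions.  As
    f <= g pointwise gives M^* diag(f(a)) M <= M^* diag(g(a)) M
    ([cdiag_loewner]), the theorem reduces to inequalities between scalar means
    of 1 and a, for a >= 0.

    This reduction needs two facts.  Powers of (I + X)/2 and (I + X^p)/2 are
    defined from some spectral decomposition of those matrices, which need not be
    the one of X; [hermfun_cdiag] shows that the functional calculus can be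
    computed in any unitary diagonalization.  And the entrywise integral
    commutes with the congruence by M ([mxint01_cdiag]), because each entry is a
    fixed linear combination of the functions v |-> a_i^v.

    On the scalar side, L(a) ln a = a - 1 ([ln_slogmean]).  Comparing L with a mean
    B is therefore comparing ln a with (a - 1)/B, and these two agree at a = 1; so
    it is enough that their difference has a derivative of constant sign
    ([derive_ge0_sign]).  With G = a^(1/2), A = (1 + a)/2, three classical
    inequalities are obtained in this way:
    - L <= (2 G + A)/3 (Carlson), in the variable a^(1/2);
    - L <= ((a^(1/3) + 1)/2)^3 (Lin), in the variable a^(1/3);
    - G^(2/3) A^(1/3) <= L (Leach and Sholander).
    In the first two the derivative is a positive multiple of (u - 1)^4, and in
    the last one its sign is an instance of the AM-GM inequality.  The ranges of
    the parameters then come from monotonicity: G <= A moves t away from 2/3 and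
    s away from 2/3, and convexity of u |-> u^(3p) moves p away from 1/3. *)

(** * Matrices congruent to a real diagonal matrix *)

Section CongruentDiagonal.
Local Open Scope sesquilinear_scope.
Context {R : realType} {n : nat}.
Implicit Types (A B M U : 'M[R[i]]_n) (d e : 'I_n -> R).

Definition rdiag d : 'M[R[i]]_n := diag_mx (\row_i (d i)%:C).

(** [M] is an arbitrary square matrix: for [M] unitary this is a spectral
    decomposition, and for [M = U *m H] with [H] Hermitian it is the congruence
    by [H] of such a decomposition. *)
Definition cdiag M d : 'M[R[i]]_n := M^t* *m rdiag d *m M.

Lemma adjmx_mul m p q (A : 'M[R[i]]_(m, p)) (B : 'M[R[i]]_(p, q)) :
  (A *m B)^t* = B^t* *m A^t*.
Proof. by rewrite trmx_mul map_mxM. Qed.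

Lemma hermsymmx_adjE A : (A \is hermsymmx) <-> A^t* = A.
Proof.
by split => [/is_hermitianmxP|h]; [|apply/is_hermitianmxP];
  rewrite expr0 scale1r.
Qed.

Lemma rdiag_adj d : (rdiag d)^t* = rdiag d.
Proof.
rewrite /rdiag tr_diag_mx map_diag_mx; congr diag_mx.
by apply/rowP => i; rewrite !mxE; exact: conjc_real.
Qed.

Lemma rdiagM d e : rdiag d *m rdiag e = rdiag (fun i => d i * e i).
Proof.
rewrite /rdiag mulmx_diag; congr diag_mx.
by apply/rowP => i; rewrite !mxE rmorphM.
Qed.

Lemma rdiag1 : rdiag (fun=> 1) = 1%:M.
Proof.
by apply/matrixP => i j; rewrite !mxE.
Qed.

Lemma rdiagD d e : rdiag d + rdiag e = rdiag (fun i => d i + e i).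
Proof.
by rewrite /rdiag -raddfD; congr diag_mx; apply/rowP => i; rewrite !mxE rmorphD.
Qed.

Lemma rdiagZ d (k : R) : k%:C *: rdiag d = rdiag (fun i => k * d i).
Proof.
by rewrite /rdiag -linearZ; congr diag_mx; apply/rowP => i; rewrite !mxE rmorphM.
Qed.

Lemma eq_cdiag M d e : d =1 e -> cdiag M d = cdiag M e.
Proof. by move=> /funext ->. Qed.

Lemma cdiag_herm M d : cdiag M d \is hermsymmx.
Proof.
by apply/hermsymmx_adjE; rewrite /cdiag !adjmx_mul rdiag_adj trmxCK mulmxA.
Qed.

Lemma cdiagD M d e : cdiag M d + cdiag M e = cdiag M (fun i => d i + e i).
Proof. by rewrite /cdiag -mulmxDl -mulmxDr rdiagD. Qed.

Lemma cdiagZ M d (k : R) : k%:C *: cdiag M d = cdiag M (fun i => k * d i).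
Proof. by rewrite /cdiag scalemxAl scalemxAr rdiagZ. Qed.

Lemma cdiag_conj M A d : A^t* = A -> A *m cdiag M d *m A = cdiag (M *m A) d.
Proof. by move=> hA; rewrite /cdiag adjmx_mul hA !mulmxA. Qed.

Lemma unitarymx_Kadj U : U \is unitarymx -> U^t* *m U = 1%:M.
Proof. by move=> /unitarymxP/mulmx1C. Qed.

Lemma cdiagM U d e : U \is unitarymx ->
  cdiag U d *m cdiag U e = cdiag U (fun i => d i * e i).
Proof.
move=> /unitarymxP; rewrite /cdiag -rdiagM; move: (U^t*) => V UV.
by rewrite -!mulmxA (mulmxA U) UV mul1mx.
Qed.

Lemma cdiag1 U : U \is unitarymx -> cdiag U (fun=> 1) = 1%:M.
Proof. by move=> hU; rewrite /cdiag rdiag1 mulmx1 unitarymx_Kadj. Qed.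

Lemma cdiag_form M d (x : 'cV[R[i]]_n) :
  (x^t* *m cdiag M d *m x) 0 0 =
  \sum_i (d i)%:C * `|(M *m x) i 0| ^+ 2.
Proof.
have -> : x^t* *m cdiag M d *m x = (M *m x)^t* *m (rdiag d *m (M *m x)).
  by rewrite /cdiag trmx_mul map_mxM !mulmxA.
rewrite /rdiag mul_diag_mx mxE; apply: eq_bigr => i _.
by rewrite !mxE normCK mulrCA [X in _ * X]mulrC.
Qed.

(** The quadratic form of the difference is a combination of the squares
    |(M x)_i|^2 with the coefficients e_i - d_i. *)
Lemma cdiag_loewner M d e : (forall i, d i <= e i) ->
  loewner (cdiag M d) (cdiag M e).
Proof.
move=> de.
have eB : cdiag M e - cdiag M d = cdiag M (fun i => e i - d i).
  have -> : - cdiag M d = (-1)%:C *: cdiag M d by rewrite rmorphN rmorph1 scaleN1r.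
  by rewrite cdiagZ cdiagD; apply: eq_cdiag => i; rewrite mulN1r.
split; rewrite ?cdiag_herm//; split; rewrite eB ?cdiag_herm// => x.
rewrite cdiag_form sumr_ge0// => i _; rewrite mulr_ge0 ?exprn_ge0//.
by rewrite ler0c subr_ge0.
Qed.

Lemma hermsymmx_cdiag A : A \is hermsymmx ->
  exists2 U, U \is unitarymx & exists d, A = cdiag U d.
Proof.
move=> hA; exists (spectralmx A); first exact: spectral_unitarymx.
exists (fun i => complex.Re (spectral_diag A 0 i)).
have /mxOverP hE := hermitian_spectral_diag_real hA.
have sdE : \row_i (complex.Re (spectral_diag A 0 i))%:C = spectral_diag A.
  by apply/rowP => i; rewrite mxE RRe_real.
rewrite /cdiag /rdiag sdE -invmx_unitary ?spectral_unitarymx//.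
exact: (orthomx_spectralP (hermitian_normalmx hA)).
Qed.

(** U^* e_j is an eigenvector for d_j: this is how (semi-)definiteness is read
    off the diagonal. *)
Lemma cdiag_eigen U d j : U \is unitarymx ->
  ((U^t* *m delta_mx j (0 : 'I_1))^t* *m cdiag U d *m (U^t* *m delta_mx j (0 : 'I_1)))
    0 0
  = (d j)%:C.
Proof.
move=> hU; rewrite cdiag_form mulmxA (unitarymxP hU) mul1mx.
rewrite (bigD1 j)//= big1 => [|i /negbTE ij]; rewrite mxE ?ij ?eqxx/=.
  by rewrite normr1 expr1n mulr1 addr0.
by rewrite normr0 expr0n mulr0.
Qed.

Lemma possemidefmx_cdiag A : possemidefmx A ->
  exists2 U, U \is unitarymx & exists2 d, A = cdiag U d & forall i, 0 <= d i.
Proof.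
move=> [/hermsymmx_cdiag[U hU [d ->]] Age0]; exists U => //; exists d => // i.
by have := Age0 (U^t* *m delta_mx i (0 : 'I_1)); rewrite cdiag_eigen// ler0c.
Qed.

Lemma posdefmx_cdiag A : posdefmx A ->
  exists2 U, U \is unitarymx & exists2 d, A = cdiag U d & forall i, 0 < d i.
Proof.
move=> [/hermsymmx_cdiag[U hU [d ->]] Agt0]; exists U => //; exists d => // i.
have := Agt0 (U^t* *m delta_mx i (0 : 'I_1)); rewrite cdiag_eigen// ltcR; apply.
apply/eqP => /(congr1 (mulmx U)); rewrite mulmxA (unitarymxP hU) mul1mx mulmx0.
by move=> /matrixP/(_ i 0)/eqP; rewrite !mxE !eqxx/= oner_eq0.
Qed.

(** Two unitary diagonalizations P^* E P and U^* D U of the same matrix are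
    related by W = P U^*, which satisfies W D = E W.  Entrywise this says that
    W_ij <> 0 forces d_j = E_i, hence f(d_j) = f(E_i), so that
    W f(D) = f(E) W as well. *)
Lemma hermfun_cdiag (f : R -> R) U d : U \is unitarymx ->
  hermfun f (cdiag U d) = cdiag U (f \o d).
Proof.
move=> hU; set A := cdiag U d.
have hA : A \is hermsymmx := cdiag_herm U d.
have hV := spectral_unitarymx A.
have AE := orthomx_spectralP (hermitian_normalmx hA).
have UV := unitarymxP hU; have VU := unitarymx_Kadj hU.
rewrite /hermfun [RHS]/cdiag; move: AE; rewrite {1}/A /cdiag.
move: (spectralmx A) (spectral_unit A) (spectral_diag A) (U^t*) UV VU.
move=> P Pu E V UV VU AE.
have [W WE] : exists W, W = P *m V by exists (P *m V).
have WD : W *m rdiag d = diag_mx E *m W.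
  move/(congr1 (fun B => P *m B *m V)): AE.
  by rewrite WE -!mulmxA UV mulmx1 mulKVmx.
have Wf : W *m rdiag (f \o d) =
    diag_mx (map_mx (fun z => (f (complex.Re z))%:C) E) *m W.
  apply/matrixP => i j; move/matrixP/(_ i j): WD.
  rewrite /rdiag !mul_mx_diag !mul_diag_mx !mxE.
  have [->|W0] := eqVneq (W i j) 0; first by rewrite !mul0r !mulr0.
  by rewrite [X in X = _]mulrC => /(mulIf W0) <-; rewrite /= mulrC.
by rewrite -[LHS]mulmx1 -VU -!mulmxA (mulmxA P) -WE (mulmxA _ W) -Wf WE -!mulmxA mulKmx.
Qed.

Lemma mxpowR_cdiag U d p : U \is unitarymx ->
  mxpowR (cdiag U d) p = cdiag U (fun i => d i `^ p).
Proof. exact: hermfun_cdiag. Qed.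

Lemma cdiagE M d i j :
  cdiag M d i j = \sum_k (d k)%:C * (Num.conj (M k i) * M k j).
Proof.
rewrite /cdiag /rdiag mul_mx_diag mxE; apply: eq_bigr => k _.
by rewrite !mxE mulrCA mulrA.
Qed.

End CongruentDiagonal.

(** * Scalar logarithmic mean *)

Section ScalarMeans.
Context {R : realType}.
Implicit Types (a u v p q s t B : R).

(** The product with [x - 1] treats both sides of 1 at once: it makes the
    conclusion say that f has the sign of x - 1. *)
Lemma derive_ge0_sign (f df : R -> R) :
    (forall x : R, 0 < x -> is_derive x 1 f (df x)) ->
    (forall x : R, 0 < x -> 0 <= df x) -> f 1 = 0 ->
  forall x : R, 0 < x -> 0 <= (x - 1) * f x.
Proof.
move=> fdf df_ge0 f1 x x0.
have cf a b : 0 < a -> {within `[a, b], continuous f}%classic.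
  move=> a0; apply: derivable_within_continuous => y; rewrite in_itv/= => /andP[ay _].
  by have [] := fdf y (lt_le_trans a0 ay).
have [x1|x1|->] := ltgtP x 1; last by rewrite subrr mul0r.
- have d y : y \in `]x, 1[ -> is_derive y 1 f (df y).
    by rewrite in_itv/= => /andP[xy _]; apply: fdf; exact: lt_trans xy.
  have [c] := MVT x1 d (cf _ _ x0); rewrite in_itv/= f1 => /andP[xc _] h.
  have -> : (x - 1) * f x = df c * (x - 1) ^+ 2 
    by have -> : f x = - (df c * (1 - x)) by [rewrite -h sub0r opprK]; ring.
  by rewrite mulr_ge0 ?sqr_ge0// df_ge0// (lt_trans x0).
- have d y : y \in `]1, x[ -> is_derive y 1 f (df y).
    by rewrite in_itv/= => /andP[xy _]; apply: fdf; exact: lt_trans xy.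
  have [c] := MVT x1 d (cf _ _ ltr01); rewrite in_itv/= f1 => /andP[xc _] h.
  have -> : (x - 1) * f x = df c * (x - 1) ^+ 2 
    by have -> : f x = df c * (x - 1) by [rewrite -h subr0]; ring.
  by rewrite mulr_ge0 ?sqr_ge0// df_ge0// (lt_trans ltr01).
Qed.

(** The logarithmic mean of 1 and [a], that is (a - 1) / ln a when 0 < a <> 1. *)
Definition slogmean a : R := \int[lebesgue_measure]_(v in `[0%R, 1%R]) (a `^ v).

Lemma powR_le1D a v : 0 <= a -> 0 <= v <= 1 -> a `^ v <= 1 + a.
Proof.
move=> a0 /andP[v0 v1].
have [a1|a1] := leP 1 a.
  by rewrite (le_trans (ler_powR a1 v1))// powRr1// lerDr.
apply: (@le_trans _ _ (1 `^ v)); last by rewrite powR1 lerDl.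
by apply: ge0_ler_powR; rewrite // ?nnegrE ?ltW.
Qed.

Lemma integrable_powRr a : 0 <= a ->
  lebesgue_measure.-integrable `[0%R, 1%R]%classic (EFin \o powR a).
Proof.
move=> a0; apply: measurable_bounded_integrable => //.
- by rewrite /= lebesgue_measure_itv/= lte_fin ltr01 -EFinD ltry.
- exact: (measurable_funS measurableT (@subsetT _ _) (measurable_realfun.measurable_powRr a)).
- exists (1 + a); split; first exact: num_real.
  move=> M aM v /=; rewrite in_itv/= => v01.
  by rewrite ger0_norm ?powR_ge0// (le_trans (powR_le1D a0 v01))// ltW.
Qed.

Lemma slogmean_ge0 a : 0 <= slogmean a.
Proof. by apply: Rintegral_ge0 => v _; exact: powR_ge0. Qed.

(** The integrand is 1 at v = 0, since 0 `^ 0 = 1, and vanishes elsewhere. *)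
Lemma slogmean0 : slogmean 0 = 0.
Proof.
rewrite /slogmean -Rintegral_itv_obnd_cbnd.
  rewrite (@eq_Rintegral _ _ _ _ _ (cst 0)).
    by rewrite Rintegral_cst// mul0r.
  by move=> v; rewrite inE/= in_itv/= => /andP[v0 _]; rewrite powR0// gt_eqF.
apply: (integrableS _ _ _ (integrable_powRr (lexx 0))) => //.
by move=> v; rewrite /= !in_itv/= => /andP[/ltW-> ->].
Qed.

Lemma slogmean1 : slogmean 1 = 1.
Proof.
rewrite /slogmean (@eq_Rintegral _ _ _ _ _ (cst 1)).
  rewrite Rintegral_cst//= lebesgue_measure_itv/= lte_fin ltr01 /=.
  by rewrite mul1r oppr0 addr0.
by move=> v _; rewrite powR1.
Qed.

Lemma ln_slogmean a : 0 < a -> ln a * slogmean a = a - 1.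
Proof.
move=> a0; rewrite /slogmean -RintegralZl//; last exact/integrable_powRr/ltW.
have dE (v : R) : is_derive v 1 (fun v => expR (v * ln a)) (ln a * a `^ v).
  rewrite /powR gt_eqF// mulrC.
  by apply: is_derive1_comp; apply: is_derive_eq; rewrite scaler0 add0r scaler1.
have cE : continuous (fun v : R => expR (v * ln a)).
  by move=> v; apply/differentiable_continuous/derivable1_diffP; case: (dE v).
rewrite /Rintegral (@continuous_FTC2 _ _ (fun v => expR (v * ln a)))//=.
- by rewrite mul1r mul0r expR0 lnK.
- apply: continuous_subspaceT => v; apply: cvgMr.
  by rewrite /powR gt_eqF//; exact: cE.
- split => [v _||].
  + by case: (dE v).
  + exact/cvg_at_right_filter/cE.
  + exact/cvg_at_left_filter/cE.
- by move=> v _; rewrite derive1E; case: (dE v).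
Qed.

Lemma slogmean_gt0 a : 0 < a -> 0 < slogmean a.
Proof.
move=> a0; rewrite lt_def slogmean_ge0 andbT; apply/eqP => L0.
have := ln_slogmean a0; rewrite L0 mulr0 => /esym/eqP; rewrite subr_eq0 => /eqP a1.
by move: L0; rewrite a1 slogmean1 => /eqP; rewrite oner_eq0.
Qed.

(** Substituting a - 1 = L ln a, the hypothesis becomes
    0 <= (ln a)^2 L (1 - L / B), where (ln a)^2 L > 0 unless a = 1. *)
Lemma slogmean_le a B : 0 < a -> 0 < B -> (a = 1 -> 1 <= B) ->
  0 <= (a - 1) * (ln a - (a - 1) / B) -> slogmean a <= B.
Proof.
move=> a0 B0 B1; have [e|a1] := eqVneq a 1; first by rewrite e slogmean1 B1.
have l0 : 0 < ln a ^+ 2 * slogmean a.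
  rewrite mulr_gt0 ?slogmean_gt0// lt_def sqr_ge0 sqrf_eq0 andbT.
  by rewrite ln_eq0.
rewrite -(ln_slogmean a0).
have -> : ln a * slogmean a * (ln a - ln a * slogmean a / B) =
          ln a ^+ 2 * slogmean a * (1 - slogmean a / B) by field; rewrite gt_eqF.
by rewrite pmulr_rge0// subr_ge0 ler_pdivrMr// mul1r.
Qed.

(** Same substitution as in [slogmean_le]: the hypothesis becomes
    0 <= (ln a)^2 L (L / B - 1). *)
Lemma slogmean_ge a B : 0 < a -> 0 < B -> (a = 1 -> B <= 1) ->
  0 <= (a - 1) * ((a - 1) / B - ln a) -> B <= slogmean a.
Proof.
move=> a0 B0 B1; have [e|a1] := eqVneq a 1; first by rewrite e slogmean1 B1.
have l0 : 0 < ln a ^+ 2 * slogmean a.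
  rewrite mulr_gt0 ?slogmean_gt0// lt_def sqr_ge0 sqrf_eq0 andbT.
  by rewrite ln_eq0.
rewrite -(ln_slogmean a0).
have -> : ln a * slogmean a * (ln a * slogmean a / B - ln a) =
          ln a ^+ 2 * slogmean a * (slogmean a / B - 1) by field; rewrite gt_eqF.
by rewrite pmulr_rge0// subr_ge0 ler_pdivlMr// mul1r.
Qed.

(** * The inequalities of Lin, Carlson, and Leach and Sholander *)

Lemma is_derive_ln_sub_div (k : R) (f g : R -> R) (x df dg : R) :
    0 < x -> g x != 0 -> is_derive x 1 f df -> is_derive x 1 g dg ->
  is_derive x 1 (fun y => k * ln y - f y / g y)
    (k / x - (df * g x - f x * dg) / g x ^+ 2).
Proof.
move=> x0 gx0 dF dG.
have dl := is_derive1_ln x0.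
have dV := is_deriveV gx0 dG.
have dM := is_deriveM (g := fun y : R => (g y)^-1) dF dV.
have dB := is_deriveB (is_deriveZ k dl) dM.
apply: (is_derive_eq dB).
rewrite /GRing.scale/=; field.
by rewrite gx0 gt_eqF.
Qed.

(** The derivative of 3 ln u - 8 (u^3 - 1)/(u + 1)^3 is
    3 (u - 1)^4 / (u (u + 1)^4). *)
Lemma slogmean_le_lin u : 0 < u -> slogmean (u ^+ 3) <= ((u + 1) / 2) ^+ 3.
Proof.
move=> u0; apply: slogmean_le.
- by rewrite exprn_gt0.
- by rewrite exprn_gt0// divr_gt0// addr_gt0.
- move=> u1; have -> : u = 1 by apply/eqP; rewrite -(@pexpr_eq1 _ u 3) ?ltW// u1.
  by rewrite (_ : (1 + 1) / 2 = 1) ?expr1n//; field.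
pose f (x : R) := 3 * ln x - (8 * x ^+ 3 - 8) / (x + 1) ^+ 3.
have df (x : R) : 0 < x ->
    is_derive x 1 f (3 * (x - 1) ^+ 4 / (x * (x + 1) ^+ 4)).
  move=> x0; have x10 : x + 1 != 0 by rewrite gt_eqF// addr_gt0.
  have d1 : is_derive x 1 (fun y : R => 8 * y ^+ 3 - 8) (24 * x ^+ 2).
    by apply: is_derive_eq; rewrite /GRing.scale/=; ring.
  have d2 : is_derive x 1 (fun y : R => (y + 1) ^+ 3) (3 * (x + 1) ^+ 2).
    by apply: is_derive_eq; rewrite /GRing.scale/=; ring.
  have x130 : (x + 1) ^+ 3 != 0 by rewrite expf_neq0.
  apply: (is_derive_eq (is_derive_ln_sub_div 3 x0 x130 d1 d2)).
  by field; rewrite x10 gt_eqF.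
have f0 : 0 <= (u - 1) * f u.
  apply: (derive_ge0_sign df) => // [x x0|].
    by rewrite divr_ge0// mulr_ge0 ?exprn_even_ge0 ?exprn_ge0 ?addr_ge0 ?ltW.
  by rewrite /f ln1 expr1n; field.
have -> : (u ^+ 3 - 1) * (ln (u ^+ 3) - (u ^+ 3 - 1) / ((u + 1) / 2) ^+ 3) =
          (u ^+ 2 + u + 1) * ((u - 1) * f u).
  by rewrite lnXn// /f; field; rewrite gt_eqF// addr_gt0.
by rewrite mulr_ge0// !addr_ge0// ?sqr_ge0// ltW.
Qed.

(** The bound is (2 G + A)/3 for G = u and A = (1 + u^2)/2; the derivative of
    2 ln u - 6 (u^2 - 1)/(u^2 + 4 u + 1) is
    2 (u - 1)^4 / (u (u^2 + 4 u + 1)^2). *)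
Lemma slogmean_le_carlson u : 0 < u -> slogmean (u ^+ 2) <= (u ^+ 2 + 4 * u + 1) / 6.
Proof.
have Dgt0 (x : R) : 0 < x -> 0 < x ^+ 2 + 4 * x + 1.
  by move=> x0; rewrite !addr_gt0 ?exprn_gt0 ?mulr_gt0.
move=> u0; apply: slogmean_le.
- by rewrite exprn_gt0.
- by rewrite divr_gt0 ?Dgt0.
- move=> u1; have -> : u = 1 by apply/eqP; rewrite -(@pexpr_eq1 _ u 2) ?ltW// u1.
  by rewrite expr1n; lra.
pose f (x : R) := 2 * ln x - (6 * x ^+ 2 - 6) / (x ^+ 2 + 4 * x + 1).
have df (x : R) : 0 < x ->
    is_derive x 1 f (2 * (x - 1) ^+ 4 / (x * (x ^+ 2 + 4 * x + 1) ^+ 2)).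
  move=> x0; have D0 := lt0r_neq0 (Dgt0 _ x0).
  have d1 : is_derive x 1 (fun y : R => 6 * y ^+ 2 - 6) (12 * x).
    by apply: is_derive_eq; rewrite /GRing.scale/=; ring.
  have d2 : is_derive x 1 (fun y : R => y ^+ 2 + 4 * y + 1) (2 * x + 4).
    by apply: is_derive_eq; rewrite /GRing.scale/=; ring.
  apply: (is_derive_eq (is_derive_ln_sub_div 2 x0 D0 d1 d2)).
  by field; rewrite D0 gt_eqF.
have f0 : 0 <= (u - 1) * f u.
  apply: (derive_ge0_sign df) => // [x x0|].
    by rewrite divr_ge0// mulr_ge0 ?exprn_even_ge0 ?sqr_ge0// ltW.
  by rewrite /f ln1 expr1n; field.
have -> : (u ^+ 2 - 1) * (ln (u ^+ 2) - (u ^+ 2 - 1) / ((u ^+ 2 + 4 * u + 1) / 6)) =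
          (u + 1) * ((u - 1) * f u).
  by rewrite lnXn// /f; field; rewrite lt0r_neq0// Dgt0.
by rewrite mulr_ge0// addr_ge0// ltW.
Qed.

(** With B^3 = a (1 + a)/2, the derivative of ln a - (a - 1)/B is
    1/a - (a^2 + 4 a + 1)/(3 a (a + 1) B), and it is nonpositive because
    3 (a + 1) B <= a^2 + 4 a + 1. *)
Lemma slogmean_ge_leach_sholander a : 0 < a ->
  (a * ((1 + a) / 2)) `^ 3^-1 <= slogmean a.
Proof.
pose B (x : R) := (x * ((1 + x) / 2)) `^ 3^-1.
have Qgt0 (x : R) : 0 < x -> 0 < x * ((1 + x) / 2).
  by move=> x0; rewrite mulr_gt0// divr_gt0// addr_gt0.
have Bgt0 (x : R) : 0 < x -> 0 < B x by move=> x0; rewrite powR_gt0 ?Qgt0.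
have B1 : B 1 = 1 by rewrite /B mul1r (_ : (1 + 1) / 2 = 1) ?powR1//; field.
move=> a0; apply: slogmean_ge => // [|->|].
- exact: Bgt0.
- by rewrite -/(B 1) B1.
rewrite -/(B a).
pose f (x : R) := 1 * ln x - (x - 1) / B x.
have df (x : R) : 0 < x ->
    is_derive x 1 f (1 / x - (x ^+ 2 + 4 * x + 1) / (3 * x * (x + 1) * B x)).
  move=> x0; have Q0 := Qgt0 _ x0; have B0 := Bgt0 _ x0.
  have d1 : is_derive x 1 (fun y : R => y - 1) 1.
    by apply: is_derive_eq; rewrite subr0.
  have dQ : is_derive x 1 (fun y : R => y * ((1 + y) / 2)) (x + 2^-1).
    by apply: is_derive_eq; rewrite /GRing.scale/=; field.
  have d2 := @is_derive1_comp _ _ (fun y : R => y * ((1 + y) / 2)) _ _ _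
    (is_derive1_powR 3^-1 Q0) dQ.
  apply: (is_derive_eq (is_derive_ln_sub_div 1 x0 (lt0r_neq0 B0) d1 d2)).
  rewrite powRB ?lt0r_neq0 ?implybT// -/(B x) powRr1 ?ltW//.
  by field; rewrite !lt0r_neq0// addr_gt0.
have f0 : 0 <= (a - 1) * - f a.
  apply: (derive_ge0_sign (fun x x0 => is_deriveN (df x x0))) => // [x x0|].
    have B0 := Bgt0 _ x0; have x10 : 0 < x + 1 by rewrite addr_gt0.
    rewrite opprB subr_ge0 ler_pdivlMr ?mulr_gt0//.
    have -> : 1 / x * (3 * x * (x + 1) * B x) = 3 * (x + 1) * B x.
      by field; rewrite lt0r_neq0.
    have B3 : B x ^+ 3 = x * ((1 + x) / 2).
      by rewrite -powR_mulrn ?ltW// -powRrM mulVf// powRr1// ltW// Qgt0.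
    (* AM-GM for P, P and x / P, whose product is P x = B^3; after multiplication
       by P it reads 3 P^2 B <= 2 P^3 + B^3, and the difference of the two sides
       is (P - B)^2 (2 P + B). *)
    pose P := (1 + x) / 2; have P0 : 0 < P by rewrite divr_gt0// addr_gt0.
    rewrite -(ler_pM2l P0).
    have -> : P * (x ^+ 2 + 4 * x + 1) = 4 * P ^+ 3 + 2 * (x * P) by rewrite /P; field.
    rewrite -B3.
    have -> : P * (3 * (x + 1) * B x) = 6 * P ^+ 2 * B x by rewrite /P; field.
    rewrite -subr_ge0.
    have -> : 4 * P ^+ 3 + 2 * B x ^+ 3 - 6 * P ^+ 2 * B x =
              2 * (P - B x) ^+ 2 * (2 * P + B x) by ring.
    apply: mulr_ge0; first by rewrite mulr_ge0 ?sqr_ge0.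
    by apply: addr_ge0; [apply: mulr_ge0 => //|]; exact: ltW.
  by rewrite -[LHS]/(- f 1) /f ln1 mulr0 subrr mul0r subr0 oppr0.
by rewrite -[X in _ * X]opprB -[ln a]mul1r.
Qed.

(** * Parametrized inequalities between scalar means *)

Lemma powR_half_le_amean a : 0 <= a -> a `^ 2^-1 <= (1 + a) / 2.
Proof.
move=> a0; rewrite powR12_sqrt// ler_pdivlMr//.
by have := sqr_ge0 (Num.sqrt a - 1); rewrite sqrrB1 sqr_sqrtr//; lra.
Qed.

(** a^(1/2) = a^(t/2) (a^(1/2))^(1-t), where a^(1/2) <= (1 + a)/2. *)
Lemma gmean_le_powR_amean a t : 0 <= a -> 0 < t <= 1 ->
  a `^ 2^-1 <= a `^ (t / 2) * ((1 + a) / 2) `^ (1 - t).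
Proof.
move=> a0 /andP[t0 t1]; have [->|a_neq0] := eqVneq a 0.
  by rewrite powR0 ?invr_neq0// mulr_ge0 ?powR_ge0.
rewrite [X in a `^ X <= _](_ : _ = t / 2 + 2^-1 * (1 - t)); last by field.
rewrite powRD ?a_neq0 ?implybT// ler_wpM2l ?powR_ge0// powRrM.
apply: ge0_ler_powR; rewrite ?subr_ge0 ?nnegrE ?powR_ge0 ?powR_half_le_amean//.
by rewrite divr_ge0// addr_ge0.
Qed.

(** For t = 2/3 this is [slogmean_ge_leach_sholander]; increasing t replaces a
    factor ((1 + a)/2)^(t - 2/3) by the smaller (a^(1/2))^(t - 2/3). *)
Lemma powR_amean_le_slogmean a t : 0 <= a -> 2 / 3 <= t <= 1 ->
  a `^ (t / 2) * ((1 + a) / 2) `^ (1 - t) <= slogmean a.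
Proof.
rewrite le0r => /predU1P[->|a0] /andP[t0 t1].
  by rewrite powR0 ?mul0r ?slogmean_ge0//; apply/eqP; lra.
apply: le_trans (slogmean_ge_leach_sholander a0).
have : a `^ 2^-1 <= (1 + a) / 2 by exact/powR_half_le_amean/ltW.
have : 0 < (1 + a) / 2 by rewrite divr_gt0// addr_gt0.
move: ((1 + a) / 2) => P P0 aP; rewrite powRM ?(ltW a0) ?(ltW P0)//.
have -> : t / 2 = 3^-1 + 2^-1 * (t - 2 / 3) by field.
rewrite [a `^ (_ + _)]powRD ?(gt_eqF a0) ?implybT// -mulrA ler_wpM2l ?powR_ge0//.
rewrite [X in _ <= P `^ X](_ : _ = (t - 2 / 3) + (1 - t)); last by field.
rewrite [leRHS]powRD ?(gt_eqF P0) ?implybT// ler_wpM2r ?powR_ge0// powRrM.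
by apply: ge0_ler_powR; rewrite ?subr_ge0 ?nnegrE ?powR_ge0 ?(ltW P0).
Qed.

(** For s = 2/3 this is [slogmean_le_carlson] at u = a^(1/2); decreasing s moves
    weight from the geometric to the larger arithmetic mean. *)
Lemma slogmean_le_gmean_amean a s : 0 <= a -> s <= 2 / 3 ->
  slogmean a <= s * a `^ 2^-1 + (1 - s) * ((1 + a) / 2).
Proof.
rewrite le0r => /predU1P[->|a0] s23.
  by rewrite slogmean0 powR0 ?invr_neq0//; lra.
have := slogmean_le_carlson (powR_gt0 2^-1 a0).
rewrite -powR_mulrn ?powR_ge0// -powRrM mulVf// powRr1 ?(ltW a0)// => /le_trans; apply.
by have := powR_half_le_amean (ltW a0); nra.
Qed.

Lemma powR_midpoint_le u q : 0 <= u -> 1 <= q ->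
  ((u + 1) / 2) `^ q <= (u `^ q + 1) / 2.
Proof.
move=> u0 q1.
have hp : 2^-1 <= 1 :> R by rewrite invf_le1// ler1n.
have hE : 2^-1 = 1 - 2^-1 :> R by field.
have -> : (u + 1) / 2 = 2^-1 * u + (1 - 2^-1) * 1 by field.
have -> : (u `^ q + 1) / 2 = 2^-1 * u `^ q + (1 - 2^-1) * 1 `^ q.
  by rewrite powR1; field.
apply: (convex_powR q1 (Itv01 _ hp)) => //=; rewrite ?inE/= ?in_itv/= ?u0 ?ler01//.
Qed.

(** For p = 1/3 this is [slogmean_le_lin] at u = a^(1/3); the general case is
    the monotonicity of power means, here between the exponents 1 and 3 p for
    the numbers u and 1. *)
Lemma slogmean_le_power_mean a p : 0 <= a -> 3^-1 <= p ->
  slogmean a <= ((a `^ p + 1) / 2) `^ p^-1.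
Proof.
rewrite le0r => /predU1P[->|a0] p3; first by rewrite slogmean0 powR_ge0.
have p0 : 0 < p by apply: lt_le_trans p3; rewrite invr_gt0.
pose u := a `^ 3^-1; have u0 : 0 < u by exact: powR_gt0.
have uE : u ^+ 3 = a by rewrite -powR_mulrn ?powR_ge0// -powRrM mulVf// powRr1 ?ltW.
have M0 : 0 <= (u + 1) / 2 by rewrite divr_ge0// addr_ge0// ltW.
rewrite -{1}uE; apply: le_trans (slogmean_le_lin u0) _.
have -> : ((u + 1) / 2) ^+ 3 = (((u + 1) / 2) `^ (3 * p)) `^ p^-1.
  by rewrite -powRrM -mulrA mulfV ?gt_eqF// mulr1 powR_mulrn.
have -> : a `^ p = u `^ (3 * p) by rewrite -powRrM; congr powR; field.
have q1 : 1 <= 3 * p by lra.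
apply: ge0_ler_powR; rewrite ?invr_ge0 ?nnegrE ?powR_ge0 ?(ltW p0)//.
  by rewrite divr_ge0// addr_ge0// powR_ge0.
exact: powR_midpoint_le (ltW u0) q1.
Qed.

End ScalarMeans.

(** * Entrywise integrals of congruent diagonal matrices *)

Section IntegralOfCongruentDiagonals.
Context {R : realType}.

Lemma Rintegral_powR_comb (I : Type) (r : seq I) (c a : I -> R) :
    (forall i, 0 <= a i) ->
  \int[lebesgue_measure]_(v in `[0%R, 1%R]) (\sum_(i <- r) a i `^ v * c i)
  = \sum_(i <- r) slogmean (a i) * c i.
Proof.
move=> a0; pose F r' (v : R) := \sum_(i <- r') a i `^ v * c i.
suff [_ ->//] : lebesgue_measure.-integrable `[0%R, 1%R]%classic (EFin \o F r) /\
  \int[lebesgue_measure]_(v in `[0%R, 1%R]) F r v = \sum_(i <- r) slogmean (a i) * c i.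
elim: r => [|i r [IHi IHe]].
  have -> : F [::] = cst 0 by apply/funext => v; rewrite /F big_nil.
  by rewrite big_nil Rintegral_cst// mul0r; split => //; exact: integrable0.
have FE : F (i :: r) = (fun v => c i * a i `^ v + F r v).
  by apply/funext => v; rewrite /F big_cons mulrC.
have ii : lebesgue_measure.-integrable `[0%R, 1%R]%classic
    (EFin \o (fun v => c i * a i `^ v)).
  by apply: (integrableZl _ (c i) (integrable_powRr (a0 i))).
rewrite FE big_cons; split; first by apply: (integrableD _ ii IHi).
by rewrite RintegralD// RintegralZl ?IHe 1?mulrC//; exact: integrable_powRr.
Qed.

Lemma Re_sum_scale (I : Type) (r : seq I) (d : I -> R) (z : I -> R[i]) :
  complex.Re (\sum_(k <- r) (d k)%:C * z k) = \sum_(k <- r) d k * complex.Re (z k).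
Proof.
rewrite (big_morph (@complex.Re R) (id1 := 0) (op1 := +%R)) => [|[? ?] [? ?]|]//.
by apply: eq_bigr => k _; case: (z k) => x y /=; rewrite mul0r subr0.
Qed.

Lemma Im_sum_scale (I : Type) (r : seq I) (d : I -> R) (z : I -> R[i]) :
  complex.Im (\sum_(k <- r) (d k)%:C * z k) = \sum_(k <- r) d k * complex.Im (z k).
Proof.
rewrite (big_morph (@complex.Im R) (id1 := 0) (op1 := +%R)) => [|[? ?] [? ?]|]//.
by apply: eq_bigr => k _; case: (z k) => x y /=; rewrite mul0r addr0.
Qed.

Lemma mxint01_cdiag n (M : 'M[R[i]]_n) (a : 'I_n -> R) :
    (forall i, 0 <= a i) ->
  mxint01 (fun v => cdiag M (fun i => a i `^ v)) = cdiag M (fun i => slogmean (a i)).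
Proof.
move=> a0; apply/matrixP => i j; rewrite mxE.
under eq_Rintegral do rewrite cdiagE Re_sum_scale.
under [X in _ +i* X]eq_Rintegral do rewrite cdiagE Im_sum_scale.
rewrite !Rintegral_powR_comb// -Re_sum_scale -Im_sum_scale -cdiagE.
by case: (cdiag _ _ i j).
Qed.

End IntegralOfCongruentDiagonals.

(** * Simultaneous diagonalization of the means *)

Lemma mulmx_sandwich (F : comNzRingType) n (H K A B : 'M[F]_n) :
  H *m K *m H = 1%:M ->
  (H *m A *m H) *m K *m (H *m B *m H) = H *m (A *m B) *m H.
Proof.
move=> HKH; rewrite -[RHS](congr1 (fun C => H *m (C *m B) *m H) (mulmx1 A)).
by rewrite -HKH !mulmxA.
Qed.

Section SimultaneousDiagonalization.
Local Open Scope sesquilinear_scope.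
Context {R : realType} {n : nat}.
Implicit Types (S T H M : 'M[R[i]]_n).

Lemma posdefmx_sqrt S : posdefmx S ->
  exists H K : 'M[R[i]]_n, [/\ mxpowR S 2^-1 = H, mxpowR S (- 2^-1) = K,
    H^t* = H & [/\ K^t* = K, H *m K = 1%:M & S = H *m H]].
Proof.
move=> /posdefmx_cdiag[U hU [d -> d0]].
exists (cdiag U (fun i => d i `^ 2^-1)), (cdiag U (fun i => d i `^ (- 2^-1))).
have cadj e : (cdiag U e)^t* = cdiag U e by exact/hermsymmx_adjE/cdiag_herm.
split; [exact: mxpowR_cdiag|exact: mxpowR_cdiag|exact: cadj|split].
- exact: cadj.
- rewrite (cdiagM _ _ hU) -(cdiag1 hU); apply: eq_cdiag => i.
  by rewrite powRN mulfV// gt_eqF// powR_gt0.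
- rewrite (cdiagM _ _ hU); apply: eq_cdiag => i; rewrite -powRD ?gt_eqF ?implybT//.
  by rewrite (_ : 2^-1 + 2^-1 = 1) ?powRr1 ?ltW//; field.
Qed.

Lemma possemidefmx_conj A H : H^t* = H -> possemidefmx A ->
  possemidefmx (H *m A *m H).
Proof.
move=> hH [hA A0]; split => [|x].
  by apply/hermsymmx_adjE; rewrite !adjmx_mul hH (proj1 (hermsymmx_adjE _) hA) mulmxA.
by have := A0 (H *m x); rewrite adjmx_mul hH !mulmxA.
Qed.

End SimultaneousDiagonalization.

Theorem theorem2p7 (R : realType) (n : nat) (S T : 'M[R[i]]_n)
    (hS : posdefmx S) (hT : possemidefmx T) :
  (forall t s : R, 2 / 3 <= t -> t <= 1 -> 0 <= s -> s <= 2 / 3 ->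
    [/\ gmean S T
          <=L wgmean (t / 2) S T *m invmx S *m wgmean (1 - t) S (amean S T),
        wgmean (t / 2) S T *m invmx S *m wgmean (1 - t) S (amean S T)
          <=L logmean S T,
        logmean S T
          <=L s%:C *: gmean S T + (1 - s)%:C *: amean S T
      & s%:C *: gmean S T + (1 - s)%:C *: amean S T
          <=L amean S T])
  /\
  (forall p : R, 1 / 3 <= p ->
    logmean S T
      <=L mxpowR S 2^-1
          *m mxpowR (2^-1 *: (mxpowR (relmx S T) p + 1%:M)) (1 / p)
          *m mxpowR S 2^-1).
Proof.
have [H [K [HE KE hH [hK HK SE]]]] := posdefmx_sqrt hS.
have KH : K *m H = 1%:M := mulmx1C HK.
have [U hU [a XE a0]] : exists2 U, U \is unitarymx &
    exists2 a, relmx S T = cdiag U a & forall i, 0 <= a i.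
  by rewrite /relmx KE; exact/possemidefmx_cdiag/possemidefmx_conj.
(* Every Z is the relative matrix of S and H Z H, where H = S^(1/2): this gives
   the weighted geometric means of S and H Z H from the powers of Z. *)
have relK (Z : 'M[R[i]]_n) : relmx S (H *m Z *m H) = Z.
  by rewrite /relmx KE !mulmxA KH mul1mx -mulmxA HK mulmx1.
have [M MU] : exists M, M = U *m H by exists (U *m H).
have MC d : H *m cdiag U d *m H = cdiag M d by rewrite MU cdiag_conj.
have TE : T = cdiag M a.
  rewrite -MC -XE /relmx KE !mulmxA HK mul1mx.
  by rewrite -mulmxA KH mulmx1.
have S1 : S = cdiag M (fun=> 1) by rewrite -MC (cdiag1 hU) mulmx1.
have wgE v b : wgmean v S (cdiag M b) = cdiag M (fun i => b i `^ v).
  rewrite /wgmean HE -MC relK (mxpowR_cdiag _ _ hU) MC; exact: erefl.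
have AE : amean S T = cdiag M (fun i => (1 + a i) / 2).
  rewrite /wamean {1}S1 TE !cdiagZ cdiagD; apply: eq_cdiag => i.
  by field.
have LE : logmean S T = cdiag M (fun i => slogmean (a i)).
  have wE : (fun v => wgmean v S T) = (fun v => cdiag M (fun i => a i `^ v)).
    by apply/funext => v; rewrite TE; exact: wgE.
  by rewrite /logmean wE; exact: mxint01_cdiag.
have mulSV d e : cdiag M d *m invmx S *m cdiag M e = cdiag M (fun i => d i * e i).
  have Su : S \in unitmx.
    rewrite SE unitmx_mul andbb.
    by have := mulmx1_unit HK => -[].
  rewrite -!MC -(cdiagM _ _ hU).
  have HSH : H *m invmx S *m H = 1%:M.
    apply: (can_inj (mulKmx (proj1 (mulmx1_unit HK)))); rewrite mulmx1.
    by rewrite !mulmxA -SE mulmxV// mul1mx.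
  exact: mulmx_sandwich HSH.
split=> [t s t23 t1 s0 s23|p p3].
  have gE : gmean S T = cdiag M (fun i => a i `^ 2^-1) by rewrite {1}TE; exact: wgE.
  have pE : wgmean (t / 2) S T *m invmx S *m wgmean (1 - t) S (amean S T) =
      cdiag M (fun i => a i `^ (t / 2) * ((1 + a i) / 2) `^ (1 - t)).
    rewrite AE {1}TE !wgE; exact: mulSV.
  have cE : s%:C *: gmean S T + (1 - s)%:C *: amean S T =
      cdiag M (fun i => s * a i `^ 2^-1 + (1 - s) * ((1 + a i) / 2)).
    rewrite gE AE !cdiagZ; exact: cdiagD.
  rewrite pE cE gE LE AE; split; apply: cdiag_loewner => i.
  - by apply: gmean_le_powR_amean => //; rewrite t1 andbT; lra.
  - by apply: powR_amean_le_slogmean => //; rewrite t1 andbT.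
  - exact: slogmean_le_gmean_amean.
  - by have := powR_half_le_amean (a0 i); nra.
have -> : mxpowR S 2^-1
          *m mxpowR (2^-1 *: (mxpowR (relmx S T) p + 1%:M)) (1 / p)
          *m mxpowR S 2^-1 = cdiag M (fun i => ((a i `^ p + 1) / 2) `^ p^-1).
  rewrite HE XE (mxpowR_cdiag _ _ hU) -(cdiag1 hU) cdiagD.
  have -> : 2^-1 = (2^-1)%:C :> R[i] by rewrite fmorphV rmorph_nat.
  rewrite cdiagZ (mxpowR_cdiag _ _ hU) MC; apply: eq_cdiag => i.
  by rewrite div1r mulrC.
rewrite LE; apply: cdiag_loewner => i; apply: slogmean_le_power_mean => //.
by rewrite -div1r.
Qed.
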